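(* Let $P$ be a program over $\langle \mathcal{P},\mathcal{D}\rangle$ and $\mathcal{X}$, and let $\mathcal{E}=B(P)\cap\mathcal{D}$ be its set of external atoms. Then $t$ is a clingo[DL]-stable model of $P$ if and only if $t$ is a $\Sigma_b$-stable model (in $\mathrm{HT}_b$) of the theory $\tau_b(P,\mathcal{X},\mathcal{E})$.
   Context: **Many-sorted $\mathrm{HT}_b$.** A signature is $\Sigma=\langle S,(\mathcal{X}_s)_{s\in S},(\mathbb{D}_s,\preceq_s)_{s\in S},\mathcal{C}\rangle$ with $S$ a set of sorts, $(\mathcal{X}_s)$ a partition of a set $\mathcal{X}$ of variables, $(\mathbb{D}_s,\preceq_s)$ non-empty partially ordered sets, $\mathbb{D}=\bigcup_s\mathbb{D}_s$, and $\mathcal{C}$ a set of constraint atoms. A valuation over $\Sigma$ is a partial function $v\subseteq\mathcal{X}\times\mathbb{D}$ such that each $(x,d)\in v$ lies in $\mathcal{X}_s\times\mathbb{D}_s$ for some $s$; write $v(x)=\boldsymbol{u}$ if $x$ is undefined in $v$, and $\mathrm{dom}(v)$ for the set of variables defined in $v$. The downward closure is $v{\downarrow}=\{(x,d)\mid (x,c)\in v, x\in\mathcal{X}_s, d\in\mathbb{D}_s, d\preceq_s c\}$. Formulas are built from $\bot$, atoms $c\in\mathcal{C}$, $\wedge,\vee,\to$, with $\neg\varphi:=\varphi\to\bot$, $\top:=\bot\to\bot$; a theory is a set of formulas. A denotation maps each atom $c$ to a set $[\![c]\!]$ of valuations. An interpretation is a pair $\langle h,t\rangle$ of valuations with $h{\downarrow}\subseteq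 t{\downarrow}$. Satisfaction: $\langle h,t\rangle\not\models\bot$; $\langle h,t\rangle\models c$ iff $h\in[\![c]\!]$ and $t\in[\![c]\!]$; $\wedge,\vee$ as usual; $\langle h,t\rangle\models\varphi_1\to\varphi_2$ iff for each $v\in\{h,t\}$: $\langle v,t\rangle\not\models\varphi_1$ or $\langle v,t\rangle\models\varphi_2$. A valuation $t$ is a $\Sigma$-stable model of a theory $\Gamma$ if $\langle t,t\rangle\models\Gamma$ and there is no valuation $h$ over $\Sigma$ with $h{\downarrow}\subset t{\downarrow}$ (strict) and $\langle h,t\rangle\models\Gamma$. **$\mathrm{HT}_c$.** A signature is $\langle\mathcal{X},\mathbb{D},\mathcal{C}\rangle$ (one unordered non-empty domain); valuations are arbitrary partial functions from $\mathcal{X}$ to $\mathbb{D}$; interpretations are pairs $\langle h,t\rangle$ with $h\subseteq t$. Satisfaction $\models_c$ is defined by: $\langle h,t\rangle\not\models_c\bot$; $\langle h,t\rangle\models_c c$ iff $h\in[\![c]\!]$ and $t\in[\![c]\!]$, for atoms $c\in\mathcal{C}$; $\langle h,t\rangle\models_c\varphi_1\wedge\varphi_2$ iff $\langle h,t\rangle\models_c\varphi_1$ and $\langle h,t\rangle\models_c\varphi_2$; $\langle h,t\rangle\models_c\varphi_1\vee\varphi_2$ iff $\langle h,t\rangle\models_c\varphi_1$ or $\langle h,t\rangle\models_c\varphi_2$; $\langle h,t\rangle\models_c\varphi_1\to\varphi_2$ iff for each $v\in\{h,t\}$: $\langle v,t\rangle\not\models_c\varphi_1$ or $\langle v,t\rangle\models_c\varphi_2$.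 $t$ is a stable model of $\Gamma$ in $\mathrm{HT}_c$ if $\langle t,t\rangle\models_c\Gamma$ and there is no $h\subset t$ (strict) with $\langle h,t\rangle\models_c\Gamma$. **Programs.** $\mathcal{X}$ is a set of integer variables; $\mathcal{P}$ is a set of propositional atoms and $\mathcal{D}$ a disjoint set of difference constraint atoms (dc-atoms) of the form $\&\mathrm{diff}\{x-y\}\leq d$ with $x,y\in\mathcal{X}$, $d\in\mathbb{Z}$. The complement is $\overline{\&\mathrm{diff}\{x-y\}\leq d}=\&\mathrm{diff}\{y-x\}\leq -d-1$, and $\mathrm{vars}(\&\mathrm{diff}\{x-y\}\leq d)=\{x,y\}$. A literal is an atom of $\mathcal{P}\cup\mathcal{D}$ preceded by zero, one or two occurrences of $\neg$. A program is a set of rules $a\gets b_1,\dots,b_n$ with $a\in\mathcal{P}\cup\mathcal{D}\cup\{\bot\}$ and literals $b_i$; $B(P)$ is the set of atoms occurring in rule bodies of $P$. **Translation $\tau$.** $\tau(\bot)=\bot$; $\tau(p)$ is the atom $p=\mathbf{t}$ for $p\in\mathcal{P}$; $\tau(\&\mathrm{diff}\{x-y\}\leq d)$ is the atom $x-y\leq d$; $\tau$ commutes with $\neg$ and $\neg\neg$. $\tau(P)$ contains, for each rule, the implication $\tau(b_1)\wedge\dots\wedge\tau(b_n)\to\tau(a)$ (empty conjunction is $\top$). **Signatures and denotations.** Let $\mathcal{X}_t$ be the set of variables $p$ for $p\in\mathcal{P}$, and $\mathcal{X}_i=\mathcal{X}$. The $\mathrm{HT}_c$-signature $\Sigma_c$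 has variables $\mathcal{X}_t\cup\mathcal{X}_i$, domain $\{\mathbf{t}\}\cup\mathbb{Z}$, and atoms $p=\mathbf{t}$ ($p\in\mathcal{X}_t$), $x-y\leq d$ ($x,y\in\mathcal{X}_i$, $d\in\mathbb{Z}$), $\mathrm{def}(p)$, $\mathrm{def}(x)$, $x:\mathbb{Z}$. The $\mathrm{HT}_b$-signature $\Sigma_b$ has sorts $t,i$, variables $(\mathcal{X}_t,\mathcal{X}_i)$, ordered domains $\{\mathbf{t}\}$ (trivial order) for sort $t$ and $(\mathbb{Z},\leq)$ for sort $i$, and the same atoms as $\Sigma_c$ together with $x\leq d$, $x\geq d$ ($x\in\mathcal{X}_i$, $d\in\mathbb{Z}$). Denotations: $[\![p=\mathbf{t}]\!]=\{v\mid v(p)=\mathbf{t}\}$; $[\![x-y\leq d]\!]=\{v\mid v(x),v(y)\in\mathbb{Z},\ v(x)-v(y)\leq d\}$; $[\![x\circ d]\!]=\{v\mid v(x)\in\mathbb{Z}, v(x)\circ d\}$ for $\circ\in\{\leq,\geq\}$; $[\![\mathrm{def}(x)]\!]=\{v\mid x\in\mathrm{dom}(v)\}$; $[\![x:\mathbb{Z}]\!]=\{v\mid v(x)\in\mathbb{Z}\}$. **$\mathrm{HT}_b$ translation.** For a set $\mathcal{E}$ of dc-atoms, $\tau_b(P,\mathcal{X},\mathcal{E})=\tau(P)\cup\{x:\mathbb{Z}\to x\geq0\mid x\in\mathcal{X}\}\cup\{\tau(d)\vee\tau(\overline{d})\mid d\in\mathcal{E}\}$. **Stable models of programs.** The stable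 models of $P$ with respect to a set $\mathcal{E}\subseteq\mathcal{D}$ are the stable models in $\mathrm{HT}_c$ over $\Sigma_c$ of $\tau(P)\cup\{\mathrm{def}(p)\to p=\mathbf{t}\mid p\in\mathcal{P}\}\cup\{\mathrm{def}(x)\to x:\mathbb{Z}\mid x\in\mathcal{X}\}\cup\{\mathrm{def}(x)\mid x\in\mathrm{vars}(d), d\in\mathcal{E}\}$. **clingo[DL]-stable models.** For valuations $v,v'$, write $v\leq_{\mathcal{E}}v'$ iff (1) $\mathrm{dom}(v)=\mathrm{dom}(v')$; (2) $\{d\in\mathcal{E}\mid v\in[\![\tau(d)]\!]\}=\{d\in\mathcal{E}\mid v'\in[\![\tau(d)]\!]\}$; (3) $v(x)\leq v'(x)$ for all $x\in\mathrm{dom}(v)\cap\mathcal{X}_i$. Write $v<_{\mathcal{E}}v'$ if $v\leq_{\mathcal{E}}v'$ and $v\neq v'$. A valuation $v$ is non-negative if $v(x)\geq0$ for all $x\in\mathrm{dom}(v)\cap\mathcal{X}_i$. A non-negative valuation $t$ is a clingo[DL]-stable model of $P$ if $t$ is a stable model of $P$ with respect to $B(P)\cap\mathcal{D}$ and there is no non-negative valuation $v$ with $v<_{B(P)\cap\mathcal{D}}t$ that is a stable model of $P$ with respect to $B(P)\cap\mathcal{D}$. *)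

(* Defs.v *)
From mathcomp Require Import all_boot all_order all_algebra.
From mathcomp Require Import classical_sets.
From Stdlib Require List.
Set Implicit Arguments.
Unset Strict Implicit.
Unset Printing Implicit Defensive.
Import Order.TTheory GRing.Theory Num.Theory.
Local Open Scope classical_set_scope.
Local Open Scope ring_scope.

(* Formulas and satisfaction *)

Inductive formula (A : Type) : Type :=
| FBot
| FAtom of A
| FAnd of formula A & formula A
| FOr of formula A & formula A
| FImp of formula A & formula A.
Arguments FBot {A}.

Definition FNeg A (f : formula A) : formula A := FImp f FBot.
Definition FTop {A} : formula A := FImp FBot FBot.

Fixpoint map_formula A B (g : A -> B) (f : formula A) : formula B :=
  match f with
  | FBot => FBot
  | FAtom a => FAtom (g a)
  | FAnd f1 f2 => FAnd (map_formula g f1) (map_formula g f2)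
  | FOr f1 f2 => FOr (map_formula g f1) (map_formula g f2)
  | FImp f1 f2 => FImp (map_formula g f1) (map_formula g f2)
  end.

Definition theory (A : Type) := set (formula A).

(* A partial function from X to U is a map [X -> option U]; [None] stands for
   "undefined". *)
Definition pfun (X U : Type) := X -> option U.

Definition pdom X U (v : pfun X U) : set X := [set x | v x <> None].

Definition graph X U (v : pfun X U) : set (X * U) :=
  [set xd | v xd.1 = Some xd.2].

Definition denotation (A X U : Type) := A -> set (pfun X U).

(* HT_b and HT_c have the same satisfaction clauses; they differ only in which
   pairs (h, t) are interpretations, see [htb_interp] and [htc_interp]. *)
Fixpoint sat A X U (den : denotation A X U) (h t : pfun X U)
    (f : formula A) {struct f} : Prop :=
  match f with
  | FBot => False
  | FAtom c => den c h /\ den c t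
  | FAnd f1 f2 => sat den h t f1 /\ sat den h t f2
  | FOr f1 f2 => sat den h t f1 \/ sat den h t f2
  | FImp f1 f2 => forall v, v = h \/ v = t ->
      ~ sat den v t f1 \/ sat den v t f2
  end.

Definition sat_theory A X U (den : denotation A X U) (h t : pfun X U)
    (G : theory A) : Prop :=
  forall f, G f -> sat den h t f.

(* HT_b.  The domains are subsets of a common carrier [buniv], so that domains
   of different sorts may overlap; [ble s] is only constrained on [bdom s].
   The partition of the variables into sorts is the map [bsort_of]. *)

Record htb_signature := HTbSignature {
  bsort : Type;
  bvar : Type;
  bsort_of : bvar -> bsort;
  buniv : Type;
  bdom : bsort -> set buniv;
  ble : bsort -> buniv -> buniv -> Prop;
  batom : Type;
  bdom_nonempty : forall s, bdom s !=set0;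
  ble_refl : forall s a, bdom s a -> ble s a a;
  ble_anti : forall s a b, bdom s a -> bdom s b ->
    ble s a b -> ble s b a -> a = b;
  ble_trans : forall s a b c, bdom s a -> bdom s b -> bdom s c ->
    ble s a b -> ble s b c -> ble s a c
}.

Section HTb.
Variable S : htb_signature.
Variable den : denotation (batom S) (bvar S) (buniv S).

Definition htb_valuation (v : pfun (bvar S) (buniv S)) : Prop :=
  forall x d, v x = Some d -> bdom (bsort_of x) d.

Definition down (v : pfun (bvar S) (buniv S)) : set (bvar S * buniv S) :=
  [set xd | exists c, [/\ v xd.1 = Some c, bdom (bsort_of xd.1) xd.2
                        & ble (bsort_of xd.1) xd.2 c]].

Definition htb_interp (h t : pfun (bvar S) (buniv S)) : Prop :=
  [/\ htb_valuation h, htb_valuation t & down h `<=` down t].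

Definition htb_models (h t : pfun (bvar S) (buniv S)) (G : theory (batom S)) :=
  htb_interp h t /\ sat_theory den h t G.

Definition htb_stable (G : theory (batom S)) (t : pfun (bvar S) (buniv S)) :=
  htb_models t t G /\
  ~ exists h, down h `<` down t /\ htb_models h t G.

End HTb.

(* HT_c *)

Record htc_signature := HTcSignature {
  cvar : Type;
  cuniv : Type;
  catom : Type;
  cuniv_nonempty : inhabited cuniv
}.

Section HTc.
Variable S : htc_signature.
Variable den : denotation (catom S) (cvar S) (cuniv S).

Definition htc_interp (h t : pfun (cvar S) (cuniv S)) : Prop :=
  graph h `<=` graph t.

Definition htc_models (h t : pfun (cvar S) (cuniv S)) (G : theory (catom S)) :=
  htc_interp h t /\ sat_theory den h t G.

Definition htc_stable (G : theory (catom S)) (t : pfun (cvar S) (cuniv S)) :=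
  htc_models t t G /\
  ~ exists h, graph h `<` graph t /\ htc_models h t G.

End HTc.

(* Programs.  [PA] is the type of propositional atoms, [X] that of integer
   variables; [Diff x y d] is the dc-atom &diff{x - y} <= d. *)

Inductive dcatom (X : Type) : Type := Diff of X & X & int.

Definition dc_compl X (d : dcatom X) : dcatom X :=
  let: Diff x y k := d in Diff y x (- k - 1).

Definition dc_vars X (d : dcatom X) : set X :=
  let: Diff x y _ := d in [set x; y].

Inductive patom (PA X : Type) : Type :=
| PProp of PA
| PDiff of dcatom X.
Arguments PProp {PA X}.
Arguments PDiff {PA X}.

Inductive literal (PA X : Type) : Type :=
| LPos of patom PA X
| LNeg of patom PA X
| LNegNeg of patom PA X.

Definition lit_atom PA X (l : literal PA X) : patom PA X :=
  match l with LPos a => a | LNeg a => a | LNegNeg a => a end.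

(* The head [None] is falsity. *)
Record rule (PA X : Type) : Type := Rule {
  rhead : option (patom PA X);
  rbody : seq (literal PA X)
}.

Definition program (PA X : Type) := set (rule PA X).

Definition body_atoms PA X (P : program PA X) : set (patom PA X) :=
  [set a | exists r l, [/\ P r, List.In l (rbody r) & lit_atom l = a]].

Definition patom_over PA X (D : set (dcatom X)) (a : patom PA X) : Prop :=
  match a with PProp _ => True | PDiff d => D d end.

(* [D] is the given set of dc-atoms; all propositional atoms of type [PA] are
   available. *)
Definition program_over PA X (D : set (dcatom X)) (P : program PA X) : Prop :=
  forall r, P r ->
    (forall a, rhead r = Some a -> patom_over D a) /\
    (forall l, List.In l (rbody r) -> patom_over D (lit_atom l)).

(* The set B(P) `&` D of external atoms. *)
Definition external_atoms PA X (D : set (dcatom X)) (P : program PA X) :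
    set (dcatom X) :=
  [set d | body_atoms P (PDiff d) /\ D d].

(* The signatures Sigma_c and Sigma_b *)

Inductive variable (PA X : Type) : Type :=
| VProp of PA
| VInt of X.
Arguments VProp {PA X}.
Arguments VInt {PA X}.

Inductive value : Type :=
| Tt
| Zv of int.

Inductive sigma_c_atom (PA X : Type) : Type :=
| AProp of PA                    (* p = t *)
| ADiff of X & X & int           (* x - y <= d *)
| ADef of variable PA X          (* def(p) and def(x) *)
| AInt of X.                     (* x : Z *)
Arguments AProp {PA X}.
Arguments ADiff {PA X}.
Arguments ADef {PA X}.
Arguments AInt {PA X}.

Inductive sigma_b_atom (PA X : Type) : Type :=
| ACommon of sigma_c_atom PA X
| ALe of X & int                 (* x <= d *)
| AGe of X & int.                (* x >= d *)
Arguments ACommon {PA X}.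
Arguments ALe {PA X}.
Arguments AGe {PA X}.

Definition valuation (PA X : Type) := pfun (variable PA X) value.

Definition den_c PA X : denotation (sigma_c_atom PA X) (variable PA X) value :=
  fun a => match a with
  | AProp p => [set v | v (VProp p) = Some Tt]
  | ADiff x y d => [set v | exists m n,
      [/\ v (VInt x) = Some (Zv m), v (VInt y) = Some (Zv n) & m - n <= d]]
  | ADef x => [set v | pdom v x]
  | AInt x => [set v | exists n, v (VInt x) = Some (Zv n)]
  end.
Arguments den_c {PA X}.

Definition den_b PA X : denotation (sigma_b_atom PA X) (variable PA X) value :=
  fun a => match a with
  | ACommon c => den_c c
  | ALe x d => [set v | exists2 n, v (VInt x) = Some (Zv n) & n <= d]
  | AGe x d => [set v | exists2 n, v (VInt x) = Some (Zv n) & n >= d]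
  end.
Arguments den_b {PA X}.

Definition sigma_c (PA X : Type) : htc_signature :=
  {| cvar := variable PA X; cuniv := value; catom := sigma_c_atom PA X;
     cuniv_nonempty := inhabits Tt |}.

Inductive sort : Type := SortT | SortI.

Definition sort_of PA X (x : variable PA X) : sort :=
  match x with VProp _ => SortT | VInt _ => SortI end.

Definition sort_dom (s : sort) : set value :=
  match s with SortT => [set Tt] | SortI => range Zv end.

(* The trivial order on {t} and the usual order on Z, side by side: t and the
   integers are incomparable. *)
Definition value_le (a b : value) : Prop :=
  match a, b with
  | Tt, Tt => True
  | Zv m, Zv n => m <= n
  | _, _ => False
  end.

Lemma sort_dom_nonempty s : sort_dom s !=set0.
Proof. by case: s; [exists Tt | exists (Zv 0), 0]. Qed.

Lemma value_le_refl a : value_le a a.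
Proof. by case: a => //= n; exact: lexx. Qed.

Lemma value_le_anti a b : value_le a b -> value_le b a -> a = b.
Proof.
by case: a b => [|m] [|n] //= mn nm; congr Zv; apply/le_anti/andP.
Qed.

Lemma value_le_trans a b c : value_le a b -> value_le b c -> value_le a c.
Proof. by case: a b c => [|m] [|n] [|p] //=; exact: le_trans. Qed.

Definition sigma_b (PA X : Type) : htb_signature :=
  {| bsort := sort; bvar := variable PA X; bsort_of := @sort_of PA X;
     buniv := value; bdom := sort_dom; ble := fun=> value_le;
     batom := sigma_b_atom PA X;
     bdom_nonempty := sort_dom_nonempty;
     ble_refl := fun _ a _ => value_le_refl a;
     ble_anti := fun _ a b _ _ => @value_le_anti a b;
     ble_trans := fun _ a b c _ _ _ => @value_le_trans a b c |}.

(* Translations *)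

Definition tau_dc PA X (d : dcatom X) : sigma_c_atom PA X :=
  let: Diff x y k := d in ADiff x y k.
Arguments tau_dc {PA X}.

Definition tau_patom PA X (a : patom PA X) : sigma_c_atom PA X :=
  match a with PProp p => AProp p | PDiff d => tau_dc d end.

Definition tau_lit PA X (l : literal PA X) : formula (sigma_c_atom PA X) :=
  match l with
  | LPos a => FAtom (tau_patom a)
  | LNeg a => FNeg (FAtom (tau_patom a))
  | LNegNeg a => FNeg (FNeg (FAtom (tau_patom a)))
  end.

Definition tau_head PA X (a : option (patom PA X)) :
    formula (sigma_c_atom PA X) :=
  if a is Some b then FAtom (tau_patom b) else FBot.

Fixpoint conj_seq A (s : seq (formula A)) : formula A :=
  match s with
  | [::] => FTop
  | [:: f] => f
  | f :: s' => FAnd f (conj_seq s')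
  end.

Definition tau_rule PA X (r : rule PA X) : formula (sigma_c_atom PA X) :=
  FImp (conj_seq (map (@tau_lit PA X) (rbody r))) (tau_head (rhead r)).

Definition tau PA X (P : program PA X) : theory (sigma_c_atom PA X) :=
  [set tau_rule r | r in P].

Definition tau_b PA X (P : program PA X) (E : set (dcatom X)) :
    theory (sigma_b_atom PA X) :=
  [set map_formula ACommon f | f in tau P]
  `|` [set FImp (FAtom (ACommon (AInt x))) (FAtom (AGe x 0)) | x in [set: X]]
  `|` [set FOr (FAtom (ACommon (tau_dc d)))
               (FAtom (ACommon (tau_dc (dc_compl d)))) | d in E].

Definition tau_c PA X (P : program PA X) (E : set (dcatom X)) :
    theory (sigma_c_atom PA X) :=
  tau P
  `|` [set FImp (FAtom (ADef (VProp p))) (FAtom (AProp p)) | p in [set: PA]]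
  `|` [set FImp (FAtom (ADef (VInt x))) (FAtom (AInt x)) | x in [set: X]]
  `|` [set f | exists d x,
        [/\ E d, dc_vars d x & f = FAtom (ADef (VInt x))]].

(* Stable models of programs *)

Definition stable_wrt PA X (P : program PA X) (E : set (dcatom X))
    (t : valuation PA X) : Prop :=
  htc_stable (S := sigma_c PA X) den_c (tau_c P E) t.

(* HT_c valuations may assign t to an integer variable; [value_le] leaves such
   a value incomparable to every integer.  Stable models never contain one. *)
Definition val_le PA X (E : set (dcatom X)) (v v' : valuation PA X) : Prop :=
  [/\ pdom v = pdom v',
      [set d | E d /\ den_c (tau_dc d) v] = [set d | E d /\ den_c (tau_dc d) v']
    & forall x c c', v (VInt x) = Some c -> v' (VInt x) = Some c' ->
        value_le c c'].

Definition val_lt PA X (E : set (dcatom X)) (v v' : valuation PA X) : Prop :=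
  val_le E v v' /\ v <> v'.

Definition nonneg PA X (v : valuation PA X) : Prop :=
  forall x c, v (VInt x) = Some c -> value_le (Zv 0) c.

Definition clingo_dl_stable PA X (D : set (dcatom X)) (P : program PA X)
    (t : valuation PA X) : Prop :=
  let E := external_atoms D P in
  [/\ nonneg t, stable_wrt P E t
    & ~ exists v, [/\ nonneg v, val_lt E v t & stable_wrt P E v]].

(* Main.v *)
(** The truth of a rule body depends only on the domains of the valuations and
    on which dc-atoms of [E] they satisfy, where [E] is the set of dc-atoms
    occurring in bodies.  The axioms [d \/ compl d] of the HT_b theory force [h]
    and [t] to agree on [E], exactly as [<=_E] does.

    If [t] is clingo[DL]-stable and [(h, t)] refutes its HT_b-stability, then
    [t] restricted to [dom h] is an HT_c countermodel of [t] unless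
    [dom h = dom t].  In that case [h <_E t], and [h] is itself HT_c-stable: an
    HT_c countermodel [g] of [h] yields the countermodel of [t] obtained by
    restricting [t] to [dom g].  Conversely, an HT_c countermodel, or a smaller
    stable model, of an HT_b-stable [t] is directly an HT_b countermodel. *)
Require Import Defs.
From mathcomp Require Import all_boot all_order all_algebra.
From mathcomp Require Import boolp classical_sets zify.
From Stdlib Require List.
Set Implicit Arguments.
Unset Strict Implicit.
Unset Printing Implicit Defensive.
Import Order.TTheory GRing.Theory Num.Theory.
Local Open Scope classical_set_scope.
Local Open Scope ring_scope.

(** * Satisfaction in here-and-there pairs *)

Section Satisfaction.
Variables (A X U : Type) (den : denotation A X U).

(** Atoms are required in both worlds, so persistence holds for arbitrary pairs and serves HT_b and
    HT_c alike. *)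
Lemma sat_persist (h t : pfun X U) (f : formula A) :
  sat den h t f -> sat den t t f.
Proof.
elim: f => //=.
- by move=> a [].
- by move=> f1 IH1 f2 IH2 [/IH1 ? /IH2 ?].
- by move=> f1 IH1 f2 IH2 [/IH1|/IH2]; [left|right].
- by move=> f1 _ f2 _ H v [->|->]; apply: H; right.
Qed.

Lemma sat_FImpE (h t : pfun X U) (f g : formula A) :
  sat den h t (FImp f g) <->
  (sat den h t f -> sat den h t g) /\ (sat den t t f -> sat den t t g).
Proof.
split=> [/= H|[Hh Ht] v /= [->|->]].
- by split; [case: (H h) | case: (H t)]; auto.
- by have [/Hh|] := EM (sat den h t f); [right|left].
- by have [/Ht|] := EM (sat den t t f); [right|left].
Qed.

Lemma sat_FNeg_iff (h t h' t' : pfun X U) (f : formula A) :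
  (sat den h t f <-> sat den h' t' f) -> (sat den t t f <-> sat den t' t' f) ->
  sat den h t (FNeg f) <-> sat den h' t' (FNeg f).
Proof. by move=> hh tt; rewrite /FNeg !sat_FImpE hh tt. Qed.

Lemma sat_conj_seq (h t : pfun X U) (s : seq (formula A)) :
  sat den h t (conj_seq s) <-> (forall f, List.In f s -> sat den h t f).
Proof.
elim: s => [|f [|g s] IH].
- by split=> // _ v _; left.
- by split=> [Hf f' [<-|//]|]; [|apply; left].
- split=> [[Hf /IH Hs] f' [<-//|/Hs//]|H].
  by split; [apply: H; left | apply/IH => f' ?; apply: H; right].
Qed.

End Satisfaction.

Lemma sat_map_formula A B X U (denA : denotation A X U) (denB : denotation B X U)
    (g : A -> B) (h t : pfun X U) (f : formula A) :
  (forall a, denB (g a) = denA a) ->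
  sat denB h t (map_formula g f) <-> sat denA h t f.
Proof.
move=> denE; elim: f h => //=.
- by move=> a h; rewrite denE.
- by move=> f1 IH1 f2 IH2 h; rewrite IH1 IH2.
- by move=> f1 IH1 f2 IH2 h; rewrite IH1 IH2.
- by move=> f1 IH1 f2 IH2 h; split=> H v /H; rewrite IH1 IH2.
Qed.

(** * Typed valuations and inclusion of downward closures *)

Section Programs.
Variables (PA X : Type).
Implicit Types (v h t g : valuation PA X) (E D : set (dcatom X)).
Implicit Types (P : program PA X).

(** This is [htb_valuation] over [sigma_b]; in HT_c it is not built in but comes from the [ADef]
    axioms. *)
Definition typed v : Prop := forall x c, v x = Some c -> sort_dom (sort_of x) c.

Lemma typed_prop v p : typed v -> pdom v (VProp p) -> v (VProp p) = Some Tt.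
Proof.
by move=> tv; rewrite /pdom /=; case Ep: (v _) => [c|] // _; have /= -> := tv _ _ Ep.
Qed.

Lemma typed_int v x : typed v -> pdom v (VInt x) ->
  exists n, v (VInt x) = Some (Zv n).
Proof.
move=> tv; rewrite /pdom /=; case Ex: (v _) => [c|] // _.
by have /= [n _ <-] := tv _ _ Ex; exists n.
Qed.

Lemma pdomP v x : pdom v x <-> exists c, v x = Some c.
Proof.
rewrite /pdom /=; case: (v x) => [c|]; split=> //; last by case.
by move=> _; exists c.
Qed.

(** Inclusion of downward closures read pointwise: the domain may grow and integer values may
    increase. *)
Definition below h t : Prop :=
  forall x c, h x = Some c -> exists2 c', t x = Some c' & value_le c c'.

Lemma below_refl v : below v v.
Proof. by move=> x c Ex; exists c; last exact: value_le_refl. Qed.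

Lemma below_sub h t : graph h `<=` graph t -> below h t.
Proof.
by move=> ht x c /(ht (_, _)) Ex; exists c; last exact: value_le_refl.
Qed.

Lemma below_pdom h t : below h t -> pdom h `<=` pdom t.
Proof. by move=> ht x /pdomP [c /ht [c' Ex _]]; apply/pdomP; exists c'. Qed.

Lemma below_anti h t : below h t -> below t h -> h = t.
Proof.
move=> ht th; apply: funext => x.
case Eh: (h x) => [c|]; last first.
  by case Et: (t x) => [c|] //; have [c'] := th _ _ Et; rewrite Eh.
have [c' Et le1] := ht _ _ Eh; have [c'' + le2] := th _ _ Et.
by rewrite Eh => -[Ec]; rewrite -Ec in le2; rewrite (value_le_anti le1 le2).
Qed.

(** By reflexivity each pair of [h] lies in its own closure, provided its value belongs to the
    domain of its sort; hence [typed h]. Transitivity gives the converse. *)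
Lemma down_subP h t : typed h ->
  @Defs.down (sigma_b PA X) h `<=` @Defs.down (sigma_b PA X) t <-> below h t.
Proof.
move=> th; split=> ht.
  move=> x c Ex; have [|c' [Et _ le1]] := ht (x, c); last by exists c'.
  by exists c; split=> //=; [exact: th Ex|exact: value_le_refl].
move=> [x d] [c [/= /ht [c' Et le1] sd le2]]; exists c'; split=> //=.
exact: value_le_trans le1.
Qed.

Lemma down_properP h t : typed h -> typed t ->
  @Defs.down (sigma_b PA X) h `<` @Defs.down (sigma_b PA X) t <-> below h t /\ h <> t.
Proof.
move=> th tt; rewrite /proper; split=> [[/(down_subP _ th) ht nth]|[ht nht]].
  split=> // Eht; apply: nth; rewrite Eht; exact: subset_refl.
split; first exact/down_subP.
by move=> /(down_subP _ tt) /(below_anti ht).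
Qed.


(** * Difference constraints and external atoms *)

Definition vars_defined E v : Prop :=
  forall d x, E d -> dc_vars d x -> pdom v (VInt x).

Definition same_external E v v' : Prop :=
  forall d, E d -> den_c (tau_dc d) v <-> den_c (tau_dc d) v'.

Lemma den_dc_dom (d : dcatom X) v x :
  den_c (tau_dc d) v -> dc_vars d x -> pdom v (VInt x).
Proof.
by case: d => y z k /= [m [n [Ey Ez _]]] [] ->; apply/pdomP; eauto.
Qed.

(** Over the integers, m - n > k means n - m <= - k - 1. Definedness matters: an undefined variable
    falsifies both atoms. *)
Lemma den_dc_compl (d : dcatom X) v : typed v ->
    (forall x, dc_vars d x -> pdom v (VInt x)) ->
  ~ den_c (tau_dc d) v -> den_c (tau_dc (dc_compl d)) v.
Proof.
case: d => x y k tv dv /= nd.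
have [m Ex] := typed_int tv (dv x (or_introl erefl)).
have [n Ey] := typed_int tv (dv y (or_intror erefl)).
exists n, m; split=> //; case: (leP (m - n) k); last by lia.
by move=> ?; case: nd; exists m, n.
Qed.

Lemma den_dc_compl_excl (d : dcatom X) v :
  den_c (tau_dc d) v -> ~ den_c (tau_dc (dc_compl d)) v.
Proof.
case: d => x y k /= [m [n [-> -> le1]]] [n' [m' [[<-] [<-] le2]]]; lia.
Qed.

Lemma den_patom_sub (a : patom PA X) g t : graph g `<=` graph t ->
  den_c (tau_patom a) g -> den_c (tau_patom a) t.
Proof.
move=> gt; case: a => [p|[x y k]] /=; first exact: (gt (_, _)).
move=> [m [n [/(gt (_, _)) ? /(gt (_, _)) ? ?]]].
by exists m, n.
Qed.

(** A valuation included in [t] has the values of [t] wherever it is defined, so it decides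
    constraints over its own variables as [t] does. *)
Lemma same_external_sub E g t : graph g `<=` graph t -> vars_defined E g ->
  same_external E g t.
Proof.
move=> gt vg d Ed; split; first exact: (@den_patom_sub (PDiff d)).
have := vg d ^~ Ed; case: d {Ed} => x y k /= dg.
have /pdomP [c Ec] := dg x (or_introl erefl).
have /pdomP [c' Ec'] := dg y (or_intror erefl).
move=> [m [n [Ex Ey ?]]]; exists m, n; split=> //.
- by rewrite Ec -Ex; apply/esym/(gt (_, _)).
- by rewrite Ec' -Ey; apply/esym/(gt (_, _)).
Qed.

(** * Rules of a program and transfer of their models *)

Section Rules.
Variables (P : program PA X) (D : set (dcatom X)).
Hypothesis HP : program_over D P.
Let E := external_atoms D P.

(** A propositional atom has only one possible value, so its truth is membership in the domain; a
    dc-atom in a body is external. *)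
Lemma den_body_atom v v' (a : patom PA X) : typed v -> typed v' ->
    pdom v = pdom v' -> same_external E v v' -> body_atoms P a ->
  den_c (tau_patom a) v <-> den_c (tau_patom a) v'.
Proof.
move=> tv tv' dv ev; case: a => [p _ /=|d Bd].
  by split=> Ep; apply: typed_prop => //; [rewrite -dv|rewrite dv];
     apply/pdomP; eauto.
apply: ev; split=> //; case: Bd => r [l [Pr lr la]].
by have [_ /(_ l lr)] := HP Pr; rewrite la.
Qed.

Definition same_body v v' : Prop :=
  forall a, body_atoms P a -> den_c (tau_patom a) v <-> den_c (tau_patom a) v'.

Lemma sat_body h t h' t' (r : rule PA X) : same_body h h' -> same_body t t' ->
    P r -> sat den_c h t (conj_seq (map (@tau_lit PA X) (rbody r))) ->
  sat den_c h' t' (conj_seq (map (@tau_lit PA X) (rbody r))).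
Proof.
move=> hh tt Pr /sat_conj_seq H; apply/sat_conj_seq => f /List.in_map_iff.
move=> [l [<- lr]]; have {H} := H _ (List.in_map _ _ _ lr).
have Ba : body_atoms P (lit_atom l) by exists r, l.
(* Negation is evaluated in both worlds, so the equivalence is carried along for (t, t) as well as
   for (h, t). *)
have atE : sat den_c t t (FAtom (tau_patom (lit_atom l))) <->
    sat den_c t' t' (FAtom (tau_patom (lit_atom l))) by rewrite /= (tt _ Ba).
have ahE : sat den_c h t (FAtom (tau_patom (lit_atom l))) <->
    sat den_c h' t' (FAtom (tau_patom (lit_atom l))).
  by rewrite /= (hh _ Ba) (tt _ Ba).
case: l {lr Ba} atE ahE => a atE ahE; rewrite [tau_lit _]/=.
- by move/ahE.
- by move/(sat_FNeg_iff ahE atE).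
- by move/(sat_FNeg_iff (sat_FNeg_iff ahE atE) (sat_FNeg_iff atE atE)).
Qed.

Lemma sat_tauE h t : sat_theory den_c h t (tau P) <->
  forall r, P r -> sat den_c h t (tau_rule r).
Proof.
by split=> [H r Pr|H f [r Pr <-]]; [apply: H; exists r | apply: H].
Qed.

(** Bodies hold equally in both pairs. A true body makes the head true in [h] by the first model and
    in [t'] by the second; the last hypothesis brings it to [h']. *)
Lemma sat_tau_transfer h t h' t' :
    sat_theory den_c h t (tau P) -> sat_theory den_c t' t' (tau P) ->
    same_body h h' -> same_body t t' ->
    (forall a : patom PA X, den_c (tau_patom a) h -> den_c (tau_patom a) t' ->
      den_c (tau_patom a) h') ->
  sat_theory den_c h' t' (tau P).
Proof.
move=> /sat_tauE H /sat_tauE H' hh tt ha; apply/sat_tauE => r Pr.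
have /sat_FImpE [Hr _] := H r Pr.
have /sat_FImpE [_ Hr'] := H' r Pr.
apply/sat_FImpE; split=> // Hb.
have {Hr'} := Hr' (sat_persist Hb).
have : sat den_c h t (tau_head (rhead r)).
  by apply/Hr/(sat_body _ _ Pr Hb) => a Ba; [rewrite hh|rewrite tt].
by case: (rhead r) => //= a [ah _] [at' _]; split=> //; apply: ha.
Qed.

(** A head is an atom or falsity, so its truth at (h, t) already contains its truth at [h] alone. *)
Lemma sat_tau_diag h t : sat_theory den_c h t (tau P) -> same_body h t ->
  sat_theory den_c h h (tau P).
Proof.
move=> /sat_tauE H ht; apply/sat_tauE => r Pr; have /sat_FImpE [Hr _] := H r Pr.
have aux : sat den_c h h (conj_seq (map (@tau_lit PA X) (rbody r))) ->
    sat den_c h h (tau_head (rhead r)).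
  move=> Hb; have : sat den_c h t (tau_head (rhead r)).
    exact/Hr/(sat_body _ _ Pr Hb).
  by case: (rhead r) => //= a [].
exact/sat_FImpE.
Qed.

(** * Semantic content of the two translated theories *)

Lemma tau_cP h t : graph h `<=` graph t ->
  sat_theory den_c h t (tau_c P E) <->
  [/\ sat_theory den_c h t (tau P), typed t & vars_defined E h].
Proof.
move=> ht; split=> [H|[H tt vE]].
  split.
  - by move=> f Pf; apply: H; do 3!left.
  (* The there half of the [ADef] axioms types [t]; [h] inherits this through inclusion. *)
  - move=> y c Ec; have dt : pdom t y by apply/pdomP; exists c.
    case: y => [p|x] in Ec dt *.
    + have /sat_FImpE [_ /= Hp] :
          sat den_c h t (FImp (FAtom (ADef (VProp p))) (FAtom (AProp p))).
        by apply: H; do 2!left; right; exists p.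
      by have [_] := Hp (conj dt dt); rewrite Ec => -[].
    + have /sat_FImpE [_ /= Hx] :
          sat den_c h t (FImp (FAtom (ADef (VInt x))) (FAtom (AInt x))).
        by apply: H; left; right; exists x.
      by have [_ [n]] := Hx (conj dt dt); rewrite Ec => -[->]; exists n.
  - move=> d x Ed dx.
    have /= [] // : sat den_c h t (FAtom (ADef (VInt x))).
    by apply: H; right; exists d, x.
have th : typed h by move=> x c /(ht (_, _)) /tt.
move=> f [[[/H//|[p _ <-]]|[x _ <-]]|[d [x [Ed dx ->]]]].
- by apply/sat_FImpE; split=> /= -[d1 d2]; split; apply: typed_prop.
- by apply/sat_FImpE; split=> /= -[d1 d2]; split; apply: typed_int.
- split; first exact: vE dx.
  by have /pdomP [c /(ht (_, _)) Ec] := vE _ _ Ed dx; apply/pdomP; exists c.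
Qed.

(** The [AGe] axioms give non-negativity. Each disjunction holds through one disjunct in both
    worlds: this defines its variables in [h] and, since an atom and its complement exclude each
    other, makes [h] and [t] agree on it. *)
Lemma tau_bP h t : typed h -> typed t -> below h t ->
  sat_theory den_b h t (tau_b P E) <->
  [/\ sat_theory den_c h t (tau P), nonneg h, nonneg t, vars_defined E h
    & same_external E h t].
Proof.
move=> th tt ht; have tauE f : sat den_b h t (map_formula ACommon f) <->
    sat den_c h t f by apply: sat_map_formula.
split=> [H|[H ph pt vE hE]]; last first.
  move=> f [[[g Pg <-]|[x _ <-]]|[d Ed <-]].
  - exact/tauE/H.
  - have aux v : nonneg v -> den_c (AInt x) v -> den_b (@AGe PA X x 0) v.
      by move=> pv [n Ex]; exists n => //; apply: (pv x _ Ex).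
    by apply/sat_FImpE; split=> -[d1 d2]; split; apply: aux.
  - have [hd|hd] := EM (den_c (tau_dc d) h).
      by left; split=> //; apply/hE.
    have td : ~ den_c (tau_dc d) t by move/hE => /(_ Ed).
    right; split; apply: den_dc_compl => // x dx; first exact: vE dx.
    exact/(below_pdom ht)/(vE _ _ Ed dx).
have dE d : E d ->
    sat den_c h t (FOr (FAtom (tau_dc d)) (FAtom (tau_dc (dc_compl d)))).
  by move=> Ed; apply/tauE; apply: H; right; exists d.
have gE x : sat den_b h t (FImp (FAtom (ACommon (AInt x))) (FAtom (AGe x 0))).
  by apply: H; left; right; exists x.
split.
- by move=> f Pf; apply/tauE; apply: H; left; left; exists f.
- move=> x c hx; have dx : pdom h (VInt x) by apply/pdomP; exists c.
  have /sat_FImpE [/= gx _] := gE x.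
  case: gx => [|[n]]; last by rewrite hx => -[->].
  by split; apply: typed_int => //; apply: below_pdom dx.
- move=> x c tx; have dx : pdom t (VInt x) by apply/pdomP; exists c.
  have /sat_FImpE [_ /= gx] := gE x.
  case: gx => [|[n]]; last by rewrite tx => -[->].
  by split; apply: typed_int.
- move=> d x Ed dx; have [[hd _]|[hd _]] := dE d Ed; apply: (den_dc_dom hd) => //.
  by case: d dx {Ed hd} => y z k /= []; [right|left].
- move=> d Ed; have [[]|[hd td]] // := dE d Ed.
  by split=> /den_dc_compl_excl.
Qed.

(** * Restriction to a smaller domain *)

Definition restrict t v : valuation PA X :=
  fun x => if v x is Some _ then t x else None.

Lemma restrict_sub t v : graph (restrict t v) `<=` graph t.
Proof. by move=> [x d]; rewrite /graph /restrict /=; case: (v x). Qed.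

Lemma pdom_restrict t v : pdom v `<=` pdom t -> pdom (restrict t v) = pdom v.
Proof.
move=> vt; apply/seteqP; split=> x; have := vt x; rewrite /pdom /restrict /=;
  by case: (v x).
Qed.

Lemma typed_sub g t : graph g `<=` graph t -> typed t -> typed g.
Proof. by move=> gt tt x c /(gt (_, _)) /tt. Qed.

(** Truth at [v] puts the variables into the restricted domain; their values are those of [t], where
    the atom holds. *)
Lemma den_patom_restrict (a : patom PA X) t v : den_c (tau_patom a) v ->
  den_c (tau_patom a) t -> den_c (tau_patom a) (restrict t v).
Proof.
rewrite /restrict; case: a => [p|[x y k]] /=; first by move=> ->.
move=> [m [n [-> -> _]]] [m' [n' [-> -> le1]]]; by exists m', n'.
Qed.

Lemma same_bodyP v v' : typed v -> typed v' -> pdom v = pdom v' ->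
  same_external E v v' -> same_body v v'.
Proof. by move=> *; move=> a; apply: den_body_atom. Qed.

Lemma sub_pdom_eq g t : graph g `<=` graph t -> pdom g = pdom t -> g = t.
Proof.
move=> gt gtd; apply: funext => x; case Eg: (g x) => [c|].
  exact/esym/(gt (_, _)).
have : ~ pdom g x by rewrite /pdom /= Eg.
by rewrite gtd /pdom /=; case: (t x) => // c /(_ _) [].
Qed.

(* The countermodel is [restrict t g]. *)
Lemma stable_dom_min t g h : stable_wrt P E t -> typed g -> typed h ->
    sat_theory den_c g h (tau P) -> pdom g `<=` pdom t -> pdom h = pdom t ->
    vars_defined E g -> same_external E g t -> same_external E h t ->
  pdom g = pdom t.
Proof.
move=> [[_ /tau_cP [//|Pt tt vt]] nst] tg th Pgh gt hd vg eg eh.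
set g' := restrict t g.
have g't : graph g' `<=` graph t := @restrict_sub t g.
have g'd : pdom g' = pdom g := pdom_restrict gt.
have vg' : vars_defined E g' by move=> d x Ed dx; rewrite g'd; apply: vg dx.
apply: contrapT => ngt; apply: nst; exists g'; split.
  split=> // tg'; apply: ngt; rewrite -g'd; congr pdom.
  apply: sub_pdom_eq => //; apply/seteqP; split=> x /pdomP [c].
    by move=> /(g't (_, _)) ?; apply/pdomP; exists c.
  by move=> /(tg' (_, _)) ?; apply/pdomP; exists c.
split=> //; apply/tau_cP => //; split=> //.
(* Bodies agree in the here worlds [g] and [g'] because both agree with [t] on [E], and in the there
   worlds [h] and [t] by equal domains and equal external truth. *)
apply: (sat_tau_transfer Pgh) => //.
- apply: same_bodyP => //; first exact: typed_sub tt.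
  move=> d Ed; rewrite eg //; apply: iff_sym; exact: same_external_sub Ed.
- exact: same_bodyP.
- by move=> a; apply: den_patom_restrict.
Qed.

(** The order condition of [val_le] compares integer variables only; on propositional ones, equal
    domains and typing force equal values. *)
Lemma val_leP v v' : typed v -> typed v' ->
  val_le E v v' <-> [/\ pdom v = pdom v', same_external E v v' & below v v'].
Proof.
move=> tv tv'; split=> -[dv ev le1]; split=> //.
- move=> d Ed; have /seteqP [s1 s2] := ev.
  by split=> dd; [case: (s1 d)|case: (s2 d)].
- move=> [p|x] c Ex.
    exists c; last exact: value_le_refl.
    have -> := typed_prop tv' (_ : pdom v' (VProp p)).
      by have /= -> := tv _ _ Ex.
    by rewrite -dv; apply/pdomP; exists c.
  have /pdomP [c' Ex'] : pdom v' (VInt x) by rewrite -dv; apply/pdomP; exists c.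
  by exists c' => //; apply: le1 Ex Ex'.
- by apply/seteqP; split=> d [Ed dd]; split=> //; apply/ev.
- by move=> x c c' /le1 [c'' -> ?] [<-].
Qed.

(** * The two directions of the equivalence *)

Lemma clingo_htb t : clingo_dl_stable D P t ->
  @htb_stable (sigma_b PA X) den_b (tau_b P E) t.
Proof.
move=> [pt st nt]; have [[_ /tau_cP [//|Pt tt vt]] _] := st.
split.
  split; first by split=> //; exact: subset_refl.
  by apply/tau_bP => //; exact: below_refl.
move=> [h [/[swap] -[[th _ _]]]] /[swap] /down_properP [] // ht nht.
move=> /tau_bP [] // Pht ph _ vh eh.
have hd : pdom h = pdom t.
  by apply: (stable_dom_min st th tt Pht) => //; exact: below_pdom.
apply: nt; exists h; split=> //; first by split=> //; apply/val_leP.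
have Ph : sat_theory den_c h h (tau P).
  by apply: (sat_tau_diag Pht); apply: same_bodyP.
split; first by split=> //; apply/tau_cP.
move=> [g [[gh nhg] [_ /tau_cP [//|Pgh _ vg]]]].
have dgh : pdom g `<=` pdom h := below_pdom (below_sub gh).
have gE := same_external_sub gh vg.
apply: nhg; rewrite (sub_pdom_eq gh) // hd.
apply: (stable_dom_min st _ th Pgh) => //; first exact: typed_sub th.
- by rewrite -hd.
- by move=> d Ed; rewrite gE // eh.
Qed.

Lemma htb_clingo t : @htb_stable (sigma_b PA X) den_b (tau_b P E) t ->
  clingo_dl_stable D P t.
Proof.
move=> [[[tt _ _] /tau_bP [] //]]; first exact: below_refl.
move=> Pt pt _ vt _ nst.
have refute h : typed h -> below h t -> h <> t ->
    ~ sat_theory den_b h t (tau_b P E).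
  move=> th ht nht H; apply: nst; exists h.
  have prp : @Defs.down (sigma_b PA X) h `<` @Defs.down (sigma_b PA X) t.
    exact/down_properP.
  by split=> //; split=> //; split=> //; case: prp.
split=> //.
  split; first by split=> //; apply/tau_cP.
  move=> [h [[ht nth] [_ /tau_cP [//|Pht _ vh]]]].
  have th := typed_sub ht tt.
  apply: (refute h) => //; first exact: below_sub.
    by move=> Eht; apply: nth; rewrite Eht; exact: subset_refl.
  apply/tau_bP => //; first exact: below_sub.
  split=> //; last exact: same_external_sub.
  by move=> x c /(ht (_, _)) /pt.
move=> [v [pv [/[swap] nvt + [[_ /tau_cP [//|Pv tv vv]] _]]]].
move=> /val_leP [] // dv ev vt'.
apply: (refute v) => //; apply/tau_bP => //; split=> //.
(* From (v, v) to (v, t) only the there world changes, so the condition on heads is immediate. *)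
apply: (sat_tau_transfer Pv) => //; exact: same_bodyP.
Qed.

End Rules.
End Programs.

Theorem theorem2 (PA X : Type) (D : set (dcatom X)) (P : program PA X)
    (HP : program_over D P) (t : valuation PA X) :
  clingo_dl_stable D P t <->
  @htb_stable (sigma_b PA X) den_b (tau_b P (external_atoms D P)) t.
Proof. by split; [exact: clingo_htb|exact: htb_clingo]. Qed.
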